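(* Let $\mathcal{A}=(Q,\delta,I,\Gamma,p,\mathit{Acc})$ be an $\mathrm{Inf}$-TELA with $n=|Q|$ and let $\mathcal{B}$ be the Büchi automaton constructed from $\mathcal{A}$ as described in the context. Let $k=|\mathrm{Min}|$. Then the number of states of $\mathcal{B}$ is in $O(k^n\cdot\mathrm{tight}(n+1))$, which (using the known estimate $\mathrm{tight}(n)\approx(0.76n)^n$) is $O(n(0.76nk)^n)$.
   Context: TELA: $\mathcal{A}=(Q,\delta,I,\Gamma,p,\mathit{Acc})$ with finite states $Q$, transitions $\delta\subseteq Q\times\Sigma\times Q$, initial states $I$, colours $\Gamma=\{0,\dots,k'-1\}$, colouring $p:\delta\to2^\Gamma$, and acceptance formula $\mathit{Acc}$ built from $\mathit{true},\mathit{false},\mathrm{Inf}(c),\mathrm{Fin}(c)$ by $\wedge,\vee$. An $\mathrm{Inf}$-TELA has no $\mathrm{Fin}$ atoms in $\mathit{Acc}$. $\delta(S,a)=\{q'\mid\exists q\in S:(q,a,q')\in\delta\}$. $\overline{\mathit{Acc}}$: the negation of $\mathit{Acc}$ in negation normal form with each $\neg\mathrm{Inf}(c)$ written as the propositional variable $c$; a model is $M\subseteq\Gamma$ satisfying it; $\mathrm{Min}$ is the (assumed nonempty) set of $\subseteq$-minimal models and $\mathrm{lex}$ its lexicographically smallest element. $\lfloor k\rfloor_{\mathrm{even}}$ is the largest even number $\le k$. $\mathrm{tight}(n)$ denotes the number of functions $f:\{1,\dots,n\}\to\omega$ whose maximum $r$ is odd and whose image contains $\{1,3,\dots,r\}$.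 Level ranking $f:Q\to\{0,\dots,2n\}$, $\mathrm{rank}(f)=\max f$; level model $\mu:Q\to\mathrm{Min}$, consistent w.r.t. $f$ if $\mu(q)=\mathrm{lex}$ whenever $f(q)$ is even; $f$ is $(S,\mu)$-tight if $\mathrm{rank}(f)=r$ is odd, $f(S)\supseteq\{1,3,\dots,r\}$, $f(Q\setminus S)=\{0\}$ and $\mu$ is consistent w.r.t. $f$; $\mathcal{T}$ is the set of $f$ that are $(Q,\mu)$-tight for some $\mu$. $(f,\mu)\to_a(f',\mu')$ iff $\mu,\mu'$ consistent w.r.t. $f,f'$ and for all $q$, $q'\in\delta(q,a)$: $f'(q')\le f(q)$; if $p((q,a,q'))\cap\mu(q)\ne\emptyset$ then $f'(q')\le\lfloor f(q)\rfloor_{\mathrm{even}}$; if $\mu'(q')\neq\mu(q)$ then $f'(q')\le\lfloor f(q)\rfloor_{\mathrm{even}}$. $\mathcal{B}=(Q',\delta',I',F')$ is the transition-based Büchi automaton with $Q'=2^Q\cup Q_2$, where $Q_2$ is the set of tuples $(S,O,f,i,\mu)$ with $S,O\subseteq Q$, $f\in\mathcal{T}$, $i\in\{0,2,\dots,2n-2\}$, $\mu$ a level model, $f$ $(S,\mu)$-tight and $O\subseteq S\cap f^{-1}(i)$; $I'=\{I\}$; transitions $S\xrightarrow{a}\delta(S,a)$ for $S\subseteq Q$, $S\xrightarrow{a}(\delta(S,a),\emptyset,f,0,\mu)\in Q_2$, and $(S,O,f,i,\mu)\xrightarrow{a}(S',O',f',i',\mu')$ in $Q_2$ iff $S'=\delta(S,a)$,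 $(f,\mu)\to_a(f',\mu')$, $\mathrm{rank}(f)=\mathrm{rank}(f')$, and either ($O=\emptyset$, $i'=(i+2)\bmod(\mathrm{rank}(f')+1)$, $O'=f'^{-1}(i')$) or ($O\neq\emptyset$, $i'=i$, $O'=\delta(O,a)\cap f'^{-1}(i)$); accepting transitions are $\emptyset\xrightarrow{a}\emptyset$ and the transitions between elements of $Q_2$ whose source has $O=\emptyset$.
   Formalization: Literally O(n(0.76nk)^n) is false (k=1: tight(n) grows like (0.7645n)^n); 0.76 is replaced by a sequence θ_n with tight(n)=(θ_n n)^n converging to a constant within 0.005 of 0.76, plus the bound for any constant b with tight(n) in O((bn)^n). *)

(* Defs.v *)
(* Mathematical Components; [tight] uses the classical layer of MathComp-Analysis. *)
From mathcomp Require Import all_boot all_order.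

Set Implicit Arguments.
Unset Strict Implicit.
Unset Printing Implicit Defensive.

Inductive acc (c : nat) : Type :=
| AccTrue
| AccFalse
| AccInf of 'I_c
| AccFin of 'I_c
| AccAnd of acc c & acc c
| AccOr of acc c & acc c.
Arguments AccTrue {c}.
Arguments AccFalse {c}.

(* The value of [tela_col] matters only on triples in [tela_delta]. *)
Record tela (Q Sigma : finType) (c : nat) := Tela {
  tela_delta : {set Q * Sigma * Q};
  tela_init : {set Q};
  tela_col : Q * Sigma * Q -> {set 'I_c};
  tela_acc : acc c }.

Fixpoint fin_free c (phi : acc c) : bool :=
  match phi with
  | AccFin _ => false
  | AccAnd phi1 phi2 | AccOr phi1 phi2 => fin_free phi1 && fin_free phi2
  | _ => true
  end.

Definition inf_tela (Q Sigma : finType) c (A : tela Q Sigma c) : bool :=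
  fin_free (tela_acc A).

(* Propositional formulas in negation normal form over the colours. *)
Inductive pform (c : nat) : Type :=
| PTrue
| PFalse
| PVar of 'I_c
| PNegVar of 'I_c
| PAnd of pform c & pform c
| POr of pform c & pform c.
Arguments PTrue {c}.
Arguments PFalse {c}.

(* The variable [d] stands for ~ Inf(d), so ~ Fin(d) = Inf(d) is the negative
   literal of [d]; the latter does not arise from a [fin_free] condition. *)
Fixpoint neg_acc c (phi : acc c) : pform c :=
  match phi with
  | AccTrue => PFalse
  | AccFalse => PTrue
  | AccInf d => PVar d
  | AccFin d => PNegVar d
  | AccAnd phi1 phi2 => POr (neg_acc phi1) (neg_acc phi2)
  | AccOr phi1 phi2 => PAnd (neg_acc phi1) (neg_acc phi2)
  end.

Fixpoint sat c (M : {set 'I_c}) (psi : pform c) : bool :=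
  match psi with
  | PTrue => true
  | PFalse => false
  | PVar d => d \in M
  | PNegVar d => d \notin M
  | PAnd psi1 psi2 => sat M psi1 && sat M psi2
  | POr psi1 psi2 => sat M psi1 || sat M psi2
  end.

(* A set of colours, as the increasing word of its elements. *)
Definition colour_word c (M : {set 'I_c}) : seqlexi nat := map val (enum M).

Definition floor_even (k : nat) : nat := k./2.*2.

Section Construction.
Variables (Q Sigma : finType) (c : nat) (A : tela Q Sigma c).

Definition post (S : {set Q}) (a : Sigma) : {set Q} :=
  [set q' | [exists q in S, (q, a, q') \in tela_delta A]].

Definition min_models : {set {set 'I_c}} :=
  [set M | minset (fun N : {set 'I_c} => sat N (neg_acc (tela_acc A))) M].

(* The default [set0] is returned only when [min_models] is empty. *)
Definition lex_model : {set 'I_c} :=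
  odflt set0 [pick M in min_models |
    [forall N in min_models, (colour_word M <= colour_word N)%O]].

Definition ranking : Type := {ffun Q -> 'I_(2 * #|Q|).+1}.
Definition level : Type := {ffun Q -> {set 'I_c}}.

Implicit Types (U B : {set Q}) (f : ranking) (mu : level).

Definition rank f : nat := \max_(q : Q) f q.

Definition fiber f (i : nat) : {set Q} := [set q | f q == i :> nat].

Definition level_model mu : bool := [forall q, mu q \in min_models].

Definition consistent f mu : bool :=
  [forall q, ~~ odd (f q) ==> (mu q == lex_model)].

(* The condition f(Q \ U) = {0} is vacuous when U = Q. *)
Definition tight_for U mu f : bool :=
  [&& odd (rank f),
      [forall j : 'I_(rank f).+1, odd j ==> [exists q in U, f q == j :> nat]],
      [forall q, (q \notin U) ==> (f q == 0 :> nat)]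
    & consistent f mu].

Definition tight_rankings : {set ranking} :=
  [set f : ranking |
    [exists mu : level, level_model mu && tight_for [set: Q] mu f]].

Definition level_step (a : Sigma) f mu f' mu' : bool :=
  [&& consistent f mu, consistent f' mu' &
    [forall q, [forall q', ((q, a, q') \in tela_delta A) ==>
      [&& f' q' <= f q,
          (tela_col A (q, a, q') :&: mu q != set0) ==>
            (f' q' <= floor_even (f q))
        & (mu' q' != mu q) ==> (f' q' <= floor_even (f q))]]]].

(* A tuple (U, B, f, i, mu), where B is the breakpoint (obligation) set. The
   ['I_(2 * #|Q|)] component is the index i, restricted to even values by
   [in_Q2]. *)
Definition macrostate : Type :=
  ({set Q} * {set Q} * ranking * 'I_(2 * #|Q|) * level)%type.

Definition in_Q2 (x : macrostate) : bool :=
  let: (U, B, f, i, mu) := x in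
  [&& f \in tight_rankings, ~~ odd i, level_model mu, tight_for U mu f
    & B \subset U :&: fiber f i].

Definition Q2 : Type := {x : macrostate | in_Q2 x}.

Definition enter_Q2 (U : {set Q}) (a : Sigma) (x' : macrostate) : bool :=
  let: (U', B', f', i', mu') := x' in
  [&& U' == post U a, B' == set0 & i' == 0 :> nat].

Definition macro_step (x : macrostate) (a : Sigma) (x' : macrostate) : bool :=
  let: (U, B, f, i, mu) := x in
  let: (U', B', f', i', mu') := x' in
  [&& U' == post U a, level_step a f mu f' mu', rank f == rank f' &
      [&& B == set0, i' == (i + 2) %% (rank f' + 1) :> nat
        & B' == fiber f' i']
   || [&& B != set0, i' == i & B' == post B a :&: fiber f' i]].

Definition breakpoint (x : macrostate) : bool :=
  let: (U, B, f, i, mu) := x in B == set0.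

Definition bstate : Type := ({set Q} + Q2)%type.

Definition bstep (s : bstate) (a : Sigma) (s' : bstate) : bool :=
  match s, s' with
  | inl U, inl U' => U' == post U a
  | inl U, inr x' => enter_Q2 U a (val x')
  | inr x, inr x' => macro_step (val x) a (val x')
  | inr _, inl _ => false
  end.

Definition baccepting (s s' : bstate) : bool :=
  match s, s' with
  | inl U, inl U' => (U == set0) && (U' == set0)
  | inr x, inr _ => breakpoint (val x)
  | _, _ => false
  end.

End Construction.

(* Transition-based Buechi automata. *)
Record tba (Sigma : finType) := Tba {
  tba_state : finType;
  tba_delta : {set tba_state * Sigma * tba_state};
  tba_init : {set tba_state};
  tba_accept : {set tba_state * Sigma * tba_state} }.

Definition complement_tba (Q Sigma : finType) c (A : tela Q Sigma c)
    : tba Sigma :=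
  @Tba Sigma (bstate A)
    [set t | bstep t.1.1 t.1.2 t.2]
    [set inl (tela_init A)]
    [set t | bstep t.1.1 t.1.2 t.2 && baccepting t.1.1 t.2].

From mathcomp Require Import finmap boolp classical_sets functions cardinality.

Definition tight_fun (n : nat) (f : {ffun 'I_n -> nat}) : Prop :=
  let r := \max_(i < n) f i in
  odd r /\ forall j, odd j -> j <= r -> exists i, f i = j.

Lemma finite_tight_fun n : finite_set [set f | @tight_fun n f]%classic.
Proof.
have bound (f : {ffun 'I_n -> nat}) (i : 'I_n) : tight_fun f -> f i < 2 * n.
  case=> oddr im; set r := \max_(i < n) f i in oddr im *.
  have le_r : f i <= r by apply: (leq_bigmax i).
  have {}im (j : 'I_(r./2).+1) : exists i, f i = j.*2.+1.
    apply: im; first by rewrite /= odd_double.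
    have := ltn_ord j; rewrite ltnS -leq_double => le_j.
    have := odd_double_half r; rewrite oddr add1n => eqr.
    by rewrite -[X in _ < X]eqr ltnS.
  have [g gP] := fin_all_exists im.
  have injg : injective g.
    move=> j k /(congr1 f); rewrite !gP => -[/double_inj e]; exact/val_inj.
  have := leq_card g injg; rewrite !card_ord => ltn.
  apply: leq_ltn_trans le_r _; rewrite -(odd_double_half r) oddr add1n.
  by rewrite mul2n -doubleS leq_double.
pose h (g : {ffun 'I_n -> 'I_(2 * n)}) : {ffun 'I_n -> nat} :=
  [ffun i => val (g i)].
apply: (@sub_finite_set _ _ (range h)%classic); last first.
  exact/finite_image/finite_finset.
move=> f tf; exists [ffun i => Ordinal (bound f i tf)] => //.
by apply/ffunP => i; rewrite !ffunE.
Qed.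

(* [fset_set] is meaningful here by [finite_tight_fun]. *)
Definition tight (n : nat) : nat :=
  #|` fset_set [set f | @tight_fun n f]%classic |%fset.

(* Main.v *)
(** The states of [Q2] inject, for each index [i] and level model, into three
    copies of the tight functions on [n] points: the values 0 and 1 are freed by
    shifting ranks by two and record [Q \ S] and [O].  Hence
    [|Q'| = O(n k^n tight(n))], and [n tight(n) <= tight(n+1)].

    Removing the two topmost values of a tight function (an odd one, which is
    attained, and the even one below it) shows that the exponential generating
    function of [tight] is [1/(1-h) - 1] with [h(z) = e^(2z) - e^z].  Its radius
    of convergence is the root [ln phi] of [h = 1], with [phi] the golden ratio,
    so [tight(n)] is [n! (ln phi)^-n] up to subexponential factors, and by
    Stirling's formula [kappa = 1/(e ln phi) = 0.7645].  The two bounds on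
    [tight] come from the recurrence [tight(n) = sum_j C(n,j) (2^j - 1)
    tight(n-j)] by induction on [n]. *)
Require Import Defs.
From mathcomp Require Import all_boot all_order all_algebra.
From mathcomp Require Import all_classical all_reals all_analysis.
From mathcomp Require Import finmap zify ring lra.

Set Implicit Arguments.
Unset Strict Implicit.
Unset Printing Implicit Defensive.

Import Order.TTheory GRing.Theory Num.Theory.
Import numFieldNormedType.Exports.

(** * Tight functions, and functions covering a prescribed set of values *)

Lemma tight_funI n (f : {ffun 'I_n -> nat}) r : odd r ->
    (forall i, f i <= r) ->
    (forall j, odd j -> j <= r -> exists i, f i = j) -> tight_fun f.
Proof.
move=> oddr fle im; rewrite /tight_fun.
have -> : \max_(i < n) f i = r; last by [].
apply/eqP; rewrite eqn_leq; apply/andP; split; first exact/bigmax_leqP.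
by have [i <-] := im r oddr (leqnn r); apply: leq_bigmax.
Qed.

(** The [(r+1)/2] odd values up to the maximum [r] have distinct preimages, so [(r+1)/2 <= n]. *)
Lemma tight_fun_lt n (f : {ffun 'I_n -> nat}) i : tight_fun f -> f i < n.*2.
Proof.
case=> oddr im; set r := \max_(i < n) f i in oddr im.
have le_r : f i <= r by apply: (leq_bigmax i).
have {}im (j : 'I_(r./2).+1) : exists i, f i == j.*2.+1.
  have [||k fk] := im j.*2.+1; first by rewrite /= odd_double.
    by have := ltn_ord j; have := odd_double_half r; rewrite oddr; lia.
  by exists k; apply/eqP.
pose g j := xchoose (im j).
have gP j : f (g j) = j.*2.+1 by apply/eqP/(xchooseP (im j)).
have injg : injective g.
  by move=> j k /(congr1 f); rewrite !gP => -[/double_inj e]; apply/val_inj.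
have := leq_card g injg; rewrite !card_ord.
by have := odd_double_half r; rewrite oddr; lia.
Qed.

Lemma card_le_tight (D : finType) (X : {set D}) n
    (phi : D -> {ffun 'I_n -> nat}) :
  (forall x, x \in X -> tight_fun (phi x)) -> {in X &, injective phi} ->
  #|X| <= tight n.
Proof.
move=> tphi injphi.
have -> : #|X| = #|` [fset phi x | x in X]%fset|.
  by rewrite card_in_imfset // cardE.
apply: fsubset_leq_card; apply/fsubsetP => _ /imfsetP[x xX ->].
rewrite in_fset_set; [exact/mem_set/tphi | exact: finite_tight_fun].
Qed.

(* With [V = {0 .. 2m+1}] and [W] its odd elements, these are the tight
   functions of rank [2m+1]. *)
Definition cover_fun n N (V W : {set 'I_N}) : {set {ffun 'I_n -> 'I_N}} :=
  [set f | (f \in ffun_on (mem V)) && [forall w in W, [exists i, f i == w]]].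

Lemma card_cover_fun0 n N (V : {set 'I_N}) :
  #|cover_fun n V finset.set0| = #|V| ^ n.
Proof.
rewrite -[in RHS](card_ord n) -card_ffun_on; apply: eq_card => f.
rewrite !inE; set b := [forall w in _, _].
have -> : b = true by apply/forall_inP => w; rewrite inE.
by rewrite andbT.
Qed.

(** Split on whether [w] is attained; if it is not, the values lie in [V :\ w]. *)
Lemma card_cover_funU1 n N (V W : {set 'I_N}) w : w \notin W ->
  #|cover_fun n V W| = #|cover_fun n V (w |: W)| + #|cover_fun n (V :\ w) W|.
Proof.
move=> wW.
rewrite -(cardsID [set f : {ffun 'I_n -> 'I_N} | [exists i, f i == w]]
                  (cover_fun n V W)).
congr (_ + _); apply: eq_card => f; rewrite !inE.
  rewrite -andbA; congr (_ && _); apply/andP/forall_inP.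
    case=> /forall_inP W1 ex v; rewrite !inE => /orP[/eqP->//|]; exact: W1.
  move=> h; split; last by apply: h; rewrite setU11.
  by apply/forall_inP => v vW; apply: h; rewrite inE vW orbT.
rewrite andbCA andbA andbC [in RHS]andbC; congr (_ && _).
apply/andP/forallP => [[/forallP fV /existsPn ne] i | h].
  by rewrite !inE (ne i) fV.
by split; [apply/forallP | apply/existsPn] => i; have := h i;
  rewrite !inE => /andP[].
Qed.

(** * Finite differences, and the recurrence for [tight] *)

Section FiniteDifferences.
Local Open Scope ring_scope.

(* The [m]-th forward difference of [x ^ n] at [l]. *)
Fixpoint fdiff (R : comNzRingType) n m l : R :=
  if m is m'.+1 then fdiff R n m' l.+1 - fdiff R n m' l else l%:R ^+ n.

(** Inclusion-exclusion, one element [w] of [W] at a time: with [W :\ w] to be covered, the values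
    range over [V] or over [V :\ w], and the surplus [#|V| - #|W|] goes up by one or stays.
    Subtraction is why the count is cast into a ring. *)
Lemma card_cover_fun (R : comNzRingType) n N (V W : {set 'I_N}) :
  W \subset V -> #|cover_fun n V W|%:R = fdiff R n #|W| (#|V| - #|W|).
Proof.
move: {-2}#|W| (erefl #|W|) => m; elim: m V W => [|m IH] V W cW sWV.
  by rewrite (cards0_eq (esym cW)) card_cover_fun0 subn0 natrX.
have /card_gt0P[w wW] : (0 < #|W|)%N by rewrite -cW.
have wV : w \in V := fintype.subsetP sWV w wW.
have cW' : m = #|W :\ w| by have := cardsD1 w W; rewrite wW; lia.
have cV : #|V| = (#|V :\ w|).+1 by rewrite (cardsD1 w V) wV.
have ltWV := subset_leq_card sWV.
have sWV' : W :\ w \subset V :\ w by apply: finset.setSD.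
have := @card_cover_funU1 n N V (W :\ w) w; rewrite !inE eqxx => /(_ isT).
rewrite finset.setD1K // => /(congr1 (fun x : nat => x%:R : R)).
rewrite natrD (IH V _ cW') ?(IH _ _ cW') //; last first.
  exact: (fintype.subset_trans (finset.subsetDl _ _) sWV).
rewrite /= => e.
rewrite (_ : (#|V| - m.+1).+1 = #|V| - m)%N; last by move: ltWV; lia.
rewrite (_ : #|V| - m.+1 = #|V :\ w| - m)%N; last by rewrite cV subSS.
by rewrite e addrK.
Qed.

Lemma fdiffD (R : comNzRingType) n m l s :
  fdiff R n m (l + s)%N =
    \sum_(j < n.+1) ((s%:R ^+ j * fdiff R (n - j) m l) *+ 'C(n, j)).
Proof.
elim: m l => [|m IH] l /=.
  rewrite natrD exprDn; apply: eq_bigr => j _; first by rewrite mulrC.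
rewrite -addSn !IH -sumrB; apply: eq_bigr => j _.
by rewrite -mulrnBl -mulrBr.
Qed.

(** For [l = m] this removes the two topmost values: [j] points carry them, not all of these the
    even one, which leaves [2^j - 1] choices. *)
Lemma fdiffSS (R : comNzRingType) n m l :
  fdiff R n m.+1 l.+1 =
    \sum_(j < n.+1) (((2 ^+ j - 1) * fdiff R (n - j) m l) *+ 'C(n, j)).
Proof.
rewrite /= -[l.+2]addn2 -[l.+1]addn1 !fdiffD -sumrB; apply: eq_bigr => j _.
by rewrite -mulrnBl -mulrBl expr1n.
Qed.

Lemma fdiff_small (R : comNzRingType) n m l : (n < m)%N -> fdiff R n m l = 0.
Proof.
elim: m n l => // m IH n l ltnm.
(* The [j = 0] term cancels; the others have exponent [n - j] below the order [m]. *)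
rewrite /= -addn1 fdiffD big_ord_recl /= subn0 mulr1n mul1r.
rewrite ?expr0 ?bin0 ?mulr1n ?mul1r addrAC subrr add0r big1 // => j _.
by rewrite IH ?mulr0 ?mul0rn //= /bump; have := ltn_ord j; lia.
Qed.

Lemma fdiffn00 (R : comNzRingType) n : fdiff R n.+1 0 0 = 0.
Proof. exact: expr0n. Qed.

Arguments fdiff : simpl never.

Definition rank_le_set N m : {set 'I_N} := [set j : 'I_N | (j < m.*2)%N].
Definition odd_rank_set N m : {set 'I_N} :=
  [set j : 'I_N | odd j && (j < m.*2)%N].

Lemma card_rank_le_set N m : (m.*2 <= N)%N -> #|rank_le_set N m| = m.*2.
Proof.
move=> leN; have inj : injective (widen_ord leN).
  by move=> i j /(congr1 val) /= e; apply: val_inj.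
rewrite -[RHS](card_ord m.*2) -(card_imset _ inj).
apply: eq_card => j; rewrite !inE; apply/idP/imsetP => [lt_j | [i _ ->] /=].
  by exists (Ordinal lt_j) => //; apply: val_inj.
exact: ltn_ord.
Qed.

Lemma card_odd_rank_set N m : (m.*2 <= N)%N -> #|odd_rank_set N m| = m.
Proof.
move=> leN; have lt (j : 'I_m) : (j.*2.+1 < N)%N by have := ltn_ord j; lia.
pose g j := Ordinal (lt j).
have g_inj : injective g.
  by move=> i j /(congr1 val) /= [/double_inj e]; apply: val_inj.
rewrite -[RHS](card_ord m) -(card_imset _ g_inj).
apply: eq_card => j; rewrite !inE; apply/andP/imsetP => [[oddj lt_j]|[i _ ->]].
  have lt2 : (j./2 < m)%N by have := odd_double_half j; rewrite oddj; lia.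
  exists (Ordinal lt2) => //; apply: val_inj => /=.
  by have := odd_double_half j; rewrite oddj; lia.
by rewrite /= odd_double; split=> //; have := ltn_ord i; lia.
Qed.

(** The bounded codomain gives a finite type to count in; by [tight_fun_lt] no tight function is
    lost. *)
Definition tight_ffuns n : {set {ffun 'I_n -> 'I_n.*2}} :=
  [set f : {ffun 'I_n -> 'I_n.*2} |
    `[< tight_fun [ffun i => nat_of_ord (f i)] >]].

Lemma tightE n : tight n = #|tight_ffuns n|.
Proof.
apply/eqP; rewrite eqn_leq; apply/andP; split; last first.
  pose ev (f : {ffun 'I_n -> 'I_n.*2}) := [ffun i => nat_of_ord (f i)].
  apply: (card_le_tight (phi := ev)).
    by move=> f; rewrite inE => /asboolP.
  move=> f g _ _ /ffunP e; apply/ffunP => i; apply: val_inj.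
  by have := e i; rewrite !ffunE.
rewrite /tight; set X := fset_set _.
have sub : (X `<=` [fset ([ffun i => nat_of_ord (f i)] : {ffun 'I_n -> nat})
                    | f : {ffun 'I_n -> 'I_n.*2} in tight_ffuns n])%fset.
  apply/fsubsetP => f; rewrite in_fset_set; last exact: finite_tight_fun.
  move=> /set_mem tf; apply/imfsetP.
  exists [ffun i => Ordinal (tight_fun_lt i tf)]; last first.
    by apply/ffunP => i; rewrite !ffunE.
  rewrite /= inE; apply/asboolP; set g := (X in tight_fun X).
  by have -> : g = f by apply/ffunP => i; rewrite !ffunE.
apply: leq_trans (fsubset_leq_card sub) _.
by apply: leq_trans (leq_imfset_card _ _ _) _; rewrite -cardE.
Qed.

Lemma cover_fun_tightP n m (f : {ffun 'I_n -> 'I_n.*2}) : (m < n)%N ->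
  reflect (f \in tight_ffuns n /\ \max_(i < n) f i = m.*2.+1)
    (f \in cover_fun n (rank_le_set n.*2 m.+1) (odd_rank_set n.*2 m.+1)).
Proof.
move=> lt_mn; rewrite !inE; apply: (iffP andP).
  case=> /forallP fle /forall_inP fodd.
  have fle' i : (f i <= m.*2.+1)%N. by have := fle i; rewrite !inE doubleS ltnS.
  have hit j : odd j -> (j <= m.*2.+1)%N -> exists i, f i = j :> nat.
    move=> oddj le_j; have lt_j : (j < n.*2)%N by lia.
    have [|i /eqP fi] := existsP (fodd (Ordinal lt_j) _).
      by rewrite !inE oddj doubleS ltnS.
    by exists i; rewrite fi.
  split.
    apply/asboolP; apply: (@tight_funI _ _ m.*2.+1) => [|i|j oddj lej].
    - by rewrite /= odd_double.
    - by rewrite ffunE.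
    - by have [i <-] := hit j oddj lej; exists i; rewrite ffunE.
  apply/eqP; rewrite eqn_leq; apply/andP; split; first exact/bigmax_leqP.
  have [||i <-] := hit m.*2.+1; rewrite ?leqnn //= ?odd_double //.
  exact: leq_bigmax.
case=> /asboolP [_ hit] maxf.
have maxf' : \max_(i < n) [ffun i => nat_of_ord (f i)] i = m.*2.+1.
  by rewrite -maxf; apply: eq_bigr => i _; rewrite ffunE.
rewrite maxf' in hit; split.
  by apply/forallP => i; rewrite !inE doubleS ltnS -maxf; apply: leq_bigmax.
apply/forall_inP => w; rewrite !inE => /andP[oddw ltw].
have lew : (w <= m.*2.+1)%N by move: ltw; rewrite doubleS ltnS.
have [i fi] := hit w oddw lew.
by apply/existsP; exists i; apply/eqP/val_inj; rewrite /= -fi ffunE.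
Qed.

(** Sort by the rank [2m+1], which is below [2n]. There are [2(m+1)] available values and [m+1] odd
    ones to cover, so both order and base point are [m+1]. *)
Lemma tight_sum (R : comNzRingType) n :
  (tight n)%:R = \sum_(m < n) fdiff R n m.+1 m.+1.
Proof.
have step (m : 'I_n) : fdiff R n m.+1 m.+1 =
    #|cover_fun n (rank_le_set n.*2 m.+1) (odd_rank_set n.*2 m.+1)|%:R.
  have leN : (m.+1.*2 <= n.*2)%N by rewrite leq_double.
  rewrite card_cover_fun ?card_odd_rank_set ?card_rank_le_set //.
    by rewrite -addnn addnK.
  by apply/fintype.subsetP => j; rewrite !inE => /andP[].
rewrite tightE (eq_bigr _ (fun m _ => step m)).
rewrite -natr_sum; congr (_%:R).
under eq_bigr do rewrite -sum1_card big_mkcond.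
rewrite -sum1_card big_mkcond exchange_big; apply: eq_bigr => f _ /=.
case: ifP => [tf | ntf]; last first.
  by rewrite big1 // => m _; case: ifP => // /cover_fun_tightP[//|];
    rewrite ntf.
have [oddr _] : tight_fun [ffun i => nat_of_ord (f i)].
  by apply/asboolP; move: tf; rewrite inE.
set r := \max_(i < n) _ in oddr.
have er : \max_(i < n) f i = r by apply: eq_bigr => i _; rewrite ffunE.
have r2 := odd_double_half r; rewrite oddr add1n in r2.
have ltr : (r./2 < n)%N.
  have [i _ fi] : exists2 i : 'I_n, true & (r <= f i)%N.
    rewrite -er; case: (posnP n) => [n0 | n_gt0].
      by move: oddr; rewrite -er big1 // => i _; have := ltn_ord i; lia.
    have [|i ->] := @bigop.eq_bigmax 'I_n (fun i => nat_of_ord (f i)).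
      by rewrite card_ord.
    by exists i.
  by have := ltn_ord (f i); lia.
rewrite (bigD1 (Ordinal ltr)) //= ifT; last first.
  by apply/cover_fun_tightP => //; rewrite er r2.
rewrite big1 // => m neq; case: ifP => // /cover_fun_tightP[//|_].
rewrite er -r2 => -[/double_inj e].
by rewrite -(inj_eq val_inj) /= -e eqxx in neq.
Qed.

(* As [tight 0 = 0], this adds the constant term of [1/(1-h)]. *)
Definition tight1 n := if n is 0 then 1%N else tight n.

(** The term [m = 0] is [0^n], the added constant term. Terms with [m > n] vanish, so one range [M]
    serves all smaller [n] when sums are exchanged. *)
Lemma tight1_sum (R : comNzRingType) n M : (n <= M)%N ->
  (tight1 n)%:R = \sum_(m < M.+1) fdiff R n m m.
Proof.
move=> /subnKC <-; elim: (M - n)%N => [|d IH]; last first.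
  rewrite addnS big_ord_recr -IH fdiff_small; first exact/esym/addr0.
  exact: (leq_addr d n).
rewrite addn0; case: n => [|n]; first by rewrite big_ord1.
by rewrite big_ord_recl /= fdiffn00 add0r -tight_sum.
Qed.

Lemma tight1_rec (R : comNzRingType) n :
  (tight1 n.+1)%:R = \sum_(j < n.+1)
    (((2 ^+ j.+1 - 1) * (tight1 (n - j))%:R) *+ 'C(n.+1, j.+1)) :> R.
Proof.
rewrite (tight1_sum _ (leqnn _)) big_ord_recl /= fdiffn00 add0r.
under eq_bigr do rewrite fdiffSS.
(* The [j = 0] term has the factor [2^0 - 1 = 0]. *)
rewrite exchange_big big_ord_recl big1 /=; last first.
  by move=> m _; rewrite expr0 subrr mul0r mul0rn.
rewrite add0r; apply: eq_bigr => j _.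
rewrite (@tight1_sum _ _ n) ?leq_subr // mulr_sumr -sumrMnl.
by apply: eq_bigr => m _; rewrite /= subSS.
Qed.

End FiniteDifferences.

(** A sum of nonnegative terms dominates each of them. The term [j = 0] will absorb a factor [n]
    into [tight (n+1)], and [j = n] will absorb the [2^n] subset states. *)
Lemma tight1_ge_term n j : (j <= n)%N ->
  ((2 ^ j.+1 - 1) * tight1 (n - j) * 'C(n.+1, j.+1) <= tight1 n.+1)%N.
Proof.
move=> le_jn; rewrite -(ler_nat int) tight1_rec.
have lt_jn : (j < n.+1)%N by [].
rewrite (bigD1 (Ordinal lt_jn)) //= natrM mulr_natr natrM natrB ?expn_gt0 //.
rewrite natrX lerDl sumr_ge0 // => i _.
by rewrite mulrn_wge0 // mulr_ge0 ?ler0n // subr_ge0 exprn_ege1.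
Qed.

Lemma tight1S_ge n : (n.+1 * tight1 n <= tight1 n.+1)%N.
Proof. by have := @tight1_ge_term n 0 isT; rewrite subn0 bin1 mul1n mulnC. Qed.

Lemma tight1_ge_pow n : (2 ^ n <= 2 * tight1 n)%N.
Proof.
case: n => // n; have := tight1_ge_term (leqnn n).
rewrite subnn binn !muln1 => le; apply: leq_trans (leq_mul (leqnn 2) le).
have : (1 < 2 ^ n.+1)%N by rewrite -[1%N]/(2 ^ 0)%N ltn_exp2l.
by lia.
Qed.

(** * Counting the states by coding them as tight functions *)

Lemma card_le_fibers (D K : finType) (X : {set D}) (Y : {set K})
    (key : D -> K) b :
  (forall x, x \in X -> key x \in Y) ->
  (forall k, k \in Y -> #|[set x in X | key x == k]| <= b)%N ->
  (#|X| <= #|Y| * b)%N.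
Proof.
move=> XY le_b; rewrite -sum1_card (partition_big key (mem Y)) //=.
rewrite -sum_nat_const; apply: leq_sum => k kY.
by apply: leq_trans (le_b k kY); rewrite -sum1_card; apply/eq_leq/eq_bigl => x;
  rewrite !inE.
Qed.

Section MacrostateCount.
Variables (Q Sigma : finType) (c : nat) (A : tela Q Sigma c).

Definition macro_kind (x : macrostate Q c) : 'I_3 :=
  let: (U, B, f, i, mu) := x in
  if B != finset.set0 then inord 2
  else if U != [set: Q]%SET then inord 1 else inord 0.

(* The ranks are shifted up by two to make room for the values 0 (outside [U])
   and 1 (in [B]); when [B] is empty, 1 is taken by the states outside [U]; and
   when moreover [U = Q] nothing needs to be recorded. *)
Definition macro_code (x : macrostate Q c) (q : Q) : nat :=
  let: (U, B, f, i, mu) := x in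
  if B != finset.set0 then
    if q \in B then 1 else if q \in U then (f q).+2 else 0
  else if U != [set: Q]%SET then if q \in U then (f q).+2 else 1
  else f q.

Definition macro_fun (x : macrostate Q c) : {ffun 'I_#|Q| -> nat} :=
  [ffun j => macro_code x (enum_val j)].

(** The shift by two preserves parity, and the new odd value 1 is attained in [B] or outside [U]. *)
Lemma macro_fun_tight x : in_Q2 A x -> tight_fun (macro_fun x).
Proof.
case: x => [[[[U B] f] i] mu] /= /and5P[_ evi _ tf sB].
have [oddr /forallP hit /forallP f0 _] := and4P tf.
have frank q : (f q <= rank f)%N by apply: leq_bigmax.
have {}hit j : odd j -> (j <= rank f)%N -> exists2 q, q \in U & f q = j :> nat.
  move=> oddj; rewrite -ltnS => ltj.
  have /implyP/(_ oddj)/existsP[q /andP[qU /eqP fq]] := hit (Ordinal ltj).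
  by exists q.
have BP q : q \in B -> q \in U /\ f q = i :> nat.
  by move=> /(fintype.subsetP sB); rewrite !inE => /andP[-> /eqP].
have intro r : odd r -> (forall q, macro_code (U, B, f, i, mu) q <= r)%N ->
    (forall j, odd j -> (j <= r)%N ->
      exists q, macro_code (U, B, f, i, mu) q = j) ->
    tight_fun (macro_fun (U, B, f, i, mu)).
  move=> oddr' ler hitr; apply: (@tight_funI _ _ r) => // [j|j oddj lej].
    by rewrite ffunE.
  have [q <-] := hitr j oddj lej; exists (enum_rank q).
  by rewrite ffunE enum_rankK.
have [B0 | /set0Pn[b bB]] := eqVneq B finset.set0; last first.
  have Bn0 : B != finset.set0 by apply/set0Pn; exists b.
  apply: (intro (rank f).+2); rewrite /macro_code /= ?negbK ?Bn0 //.
    by move=> q; case: ifP => // _; case: ifP; rewrite ?ltnS.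
  case=> [|[|j]] // oddj lej; first by exists b; rewrite bB.
  have [||q qU fq] := hit j; rewrite /= ?negbK // in oddj *.
  (* States in [B] have the even rank [i], so overwriting them by 1 loses no odd rank. *)
  exists q; rewrite qU fq ifN //; apply/negP => /BP[_ fi].
  by move: oddj; rewrite -fq fi (negPf evi).
have [UT | UT] := eqVneq U [set: Q]%SET.
  apply: (intro (rank f)) => [//|q|j oddj lej];
    rewrite /macro_code B0 UT !eqxx //=.
  by have [q _ fq] := hit j oddj lej; exists q.
have /subsetPn[p _ pU] : ~~ ([set: Q]%SET \subset U) by rewrite finset.subTset.
apply: (intro (rank f).+2); rewrite /macro_code /= ?negbK ?B0 ?eqxx ?UT //=.
  by move=> q; case: ifP; rewrite ?ltnS.
case=> [|[|j]] // oddj lej; first by exists p; rewrite (negPf pU).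
have [||q qU fq] := hit j; rewrite /= ?negbK // in oddj *.
by exists q; rewrite qU fq.
Qed.

Definition macro_key (x : macrostate Q c) :
    'I_3 * ('I_(2 * #|Q|) * level Q c) :=
  let: (U, B, f, i, mu) := x in (macro_kind x, (i, mu)).

(** For a known kind, the positions of 0 and 1 determine [U] and [B]. Then [f] is [i] on [B], 0
    outside [U], and is read off the code elsewhere. *)
Lemma macro_fun_inj x y : in_Q2 A x -> in_Q2 A y ->
  macro_key x = macro_key y -> macro_fun x = macro_fun y -> x = y.
Proof.
case: x => [[[[U B] f] i] mu]; case: y => [[[[U' B'] f'] i'] mu'].
move=> /and5P[_ _ _ /and4P[_ _ /forallP f0 _] /fintype.subsetP sB].
move=> /and5P[_ _ _ /and4P[_ _ /forallP f0' _] /fintype.subsetP sB'].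
move=> [ek ei emu] /ffunP ec; move: ei emu sB' => <- <- sB'.
have {}ec q : macro_code (U, B, f, i, mu) q = macro_code (U', B', f', i, mu) q.
  by have := ec (enum_rank q); rewrite !ffunE enum_rankK.
have {}f0 q : q \notin U -> f q = 0 :> nat by move/(implyP (f0 q))/eqP.
have {}f0' q : q \notin U' -> f' q = 0 :> nat by move/(implyP (f0' q))/eqP.
have BP q : q \in B -> q \in U /\ f q = i :> nat.
  by move=> /sB; rewrite !inE => /andP[-> /eqP].
have BP' q : q \in B' -> q \in U' /\ f' q = i :> nat.
  by move=> /sB'; rewrite !inE => /andP[-> /eqP].
suff [-> -> ef] : [/\ U = U', B = B' & forall q, f q = f' q :> nat].
  by have -> : f = f' by apply/ffunP => q; apply: val_inj; apply: ef.
move: ek ec; rewrite /macro_kind /macro_code.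
(* Equal keys have equal kinds, so the mixed cases are contradictory. *)
case: (eqVneq B _) => [B0|_]; case: (eqVneq B' _) => [B0'|_] /=;
  try by case: ifP => _ /(congr1 val); rewrite /= !inordK.
  case: (eqVneq U _) => [U0|_]; case: (eqVneq U' _) => [U0'|_] /=;
    try by move=> /(congr1 val); rewrite /= !inordK.
    by move=> _ ec; split=> //; rewrite ?U0 ?U0' ?B0 ?B0'.
  move=> _ ec.
  have eU : U = U'.
    by apply/setP => q; have := ec q; do 2![case: ifP].
  split; rewrite ?B0 ?B0' // => q.
  have := ec q; rewrite -eU; case: ifP => [qU [//]|/negbT qU _].
  by rewrite f0 ?f0' // -eU.
move=> _ ec.
have eB : B = B'.
  by apply/setP => q; have := ec q; do 4![case: ifP => //].
have eU : U = U'.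
  apply/setP => q; have := ec q; rewrite -eB; case: ifP => [qB _|_].
    by rewrite (BP q qB).1 (BP' q _).1 // -eB.
  by do 2![case: ifP].
split=> // q; have := ec q; rewrite -eB -eU; case: ifP => [qB _|_].
  by rewrite (BP q qB).2 (BP' q _).2 // -eB.
case: ifP => [qU [//]|/negbT qU _].
by rewrite f0 ?f0' // -eU.
Qed.

(** There are 3 kinds, [2n] values in the index type and [k^n] level models; each fiber of
    [macro_key] injects into the tight functions. *)
Lemma card_macrostates :
  (#|[set x | in_Q2 A x]| <= 6 * #|Q| * #|min_models A| ^ #|Q| * tight #|Q|)%N.
Proof.
have card_level (M : {set {set 'I_c}}) :
    #|[set mu : level Q c | mu \in ffun_on (mem M)]| = (#|M| ^ #|Q|)%N.
  by rewrite cardsE card_ffun_on.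
pose Y := [set k : 'I_3 * ('I_(2 * #|Q|) * level Q c) |
  k.2.2 \in ffun_on (mem (min_models A))].
have -> : (6 * #|Q| * #|min_models A| ^ #|Q| = #|Y|)%N.
  have -> : Y = finset.setX [set: 'I_3]%SET
    (finset.setX [set: 'I_(2 * #|Q|)]%SET
      [set mu : level Q c | mu \in ffun_on (mem (min_models A))]).
    by apply/setP => -[a [i mu]]; rewrite !inE.
  rewrite !cardsX !cardsT !card_ord mulnA mulnA; congr (_ * _)%N.
  by rewrite card_level.
apply: (card_le_fibers (key := macro_key)).
  case=> [[[[U B] f] i] mu]; rewrite !inE => /and5P[_ _ /forallP lm _ _].
  exact/ffun_onP.
move=> k _; apply: (card_le_tight (phi := macro_fun)).
  by move=> x; rewrite !inE => /andP[/macro_fun_tight].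
move=> x y; rewrite !inE => /andP[xQ /eqP kx] /andP[yQ /eqP ky].
by apply: macro_fun_inj => //; rewrite kx ky.
Qed.

(** Since [n] and [k] are positive, the [2^n <= 2 tight(n)] subset states raise the constant from 6
    to 8. *)
Lemma card_complement : min_models A != finset.set0 -> (0 < #|Q|)%N ->
  (#|tba_state (complement_tba A)| <=
     8 * (#|Q| * (#|min_models A| ^ #|Q| * tight #|Q|)))%N.
Proof.
rewrite -card_gt0 => k_gt0 n_gt0.
rewrite /= /bstate card_sum -cardsT -powersetT card_powerset cardsT.
have -> : #|{: Q2 A}| = #|[set x | in_Q2 A x]| by rewrite card_sig cardsE.
apply: leq_trans (leq_add (tight1_ge_pow #|Q|) card_macrostates) _.
have -> : tight1 #|Q| = tight #|Q| by rewrite /tight1; case: #|Q| n_gt0.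
set t := tight _; set K := (_ ^ _)%N.
have Kgt0 : (0 < K)%N by rewrite expn_gt0 k_gt0.
have : (t <= #|Q| * (K * t))%N.
  by rewrite mulnA leq_pmull // muln_gt0 n_gt0.
by rewrite -!mulnA; set w := (_ * (K * t))%N; lia.
Qed.

(** The factor [#|Q|] in [card_macrostates] makes [Q2] empty, and only the empty subset remains. *)
Lemma card_complement0 : #|Q| = 0%N -> #|tba_state (complement_tba A)| = 1%N.
Proof.
move=> Q0; rewrite /= /bstate card_sum -cardsT -powersetT card_powerset cardsT.
have -> : #|{: Q2 A}| = #|[set x | in_Q2 A x]| by rewrite card_sig cardsE.
have := card_macrostates; set N := #|_| => leN; rewrite Q0 expn0 in leN *.
by apply/eqP; rewrite eqn_leq; lia.
Qed.

End MacrostateCount.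

Local Open Scope classical_set_scope.
Local Open Scope ring_scope.

(** * Estimates for the exponential and the factorial *)

Section Exponential.
Variable R : realType.
Implicit Types x z : R.

Lemma series_exp_le x n : 0 <= x -> series (exp_coeff x) n <= expR x.
Proof.
move=> x_ge0; apply: nondecreasing_cvgn_le; last exact: is_cvg_series_exp_coeff.
apply/nondecreasing_seqP => k.
by rewrite /series /= big_nat_recr //= lerDl exp_coeff_ge0.
Qed.

(** From index [n] on the terms at least halve, so partial sum plus twice the next term is
    nonincreasing. *)
Lemma expR_le_series x n : 0 <= x -> 2 * x <= n.+1%:R ->
  expR x <= series (exp_coeff x) n + 2 * exp_coeff x n.
Proof.
move=> x_ge0 le2x.
have step k : (n <= k)%N ->
  series (exp_coeff x) k + 2 * exp_coeff x k <=
  series (exp_coeff x) n + 2 * exp_coeff x n.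
  move=> /subnKC <-; elim: (k - n)%N => [|d IH]; first by rewrite addn0.
  apply: le_trans IH; rewrite addnS /series /= big_nat_recr //= -addrA lerD2l.
  have e0 := @exp_coeff_ge0 R x (n + d) x_ge0.
  have -> : exp_coeff x (n + d).+1 = exp_coeff x (n + d) * (x / (n + d).+1%:R).
    rewrite /exp_coeff /= exprSr factS natrM; field.
    by rewrite -natrD nat1r !pnatr_eq0 -!lt0n fact_gt0.
  have : x / (n + d).+1%:R <= 2^-1.
    rewrite ler_pdivrMr ?ltr0n //; suff : n.+1%:R <= (n + d).+1%:R :> R by lra.
    by rewrite ler_nat ltnS leq_addr.
  by move: (x / _) (exp_coeff _ _) e0 => t u u_ge0 /(ler_wpM2l u_ge0); lra.
apply: limr_le; first exact: is_cvg_series_exp_coeff.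
near=> k; apply: le_trans (step k _); last by near: k; exact: nbhs_infty_ge.
by rewrite lerDl mulr_ge0 // exp_coeff_ge0.
Unshelve. all: by end_near. Qed.

(** The single term [n^n / n!] of the series for [e^n] is at most [e^n]. *)
Lemma factr_ge n : (n%:R / expR 1) ^+ n <= n`!%:R :> R.
Proof.
have e_gt0 := expR_gt0 (1 : R).
rewrite expr_div_n ler_pdivrMr ?exprn_gt0 // -expRM_natr mul1r.
have := @series_exp_le n%:R n.+1 (ler0n _ _).
rewrite /series /= big_nat_recr //= => /(le_trans _) le.
rewrite -ler_pdivrMl ?ltr0n ?fact_gt0 // mulrC; apply: le.
by rewrite lerDr sumr_ge0 // => i _; apply: exp_coeff_ge0.
Qed.

(** The induction step reduces to [(1 - 1/(n+2))^(n+2) <= 1/e], an instance of [1 + x <= e^x]. *)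
Lemma factr_le n :
  n.+1`!%:R <= expR 1 * n.+1%:R * (n.+1%:R / expR 1) ^+ n.+1 :> R.
Proof.
have e_gt0 := expR_gt0 (1 : R).
elim: n => [|n IH].
  by rewrite expr1 mulr1 div1r mulfV ?gt_eqF.
rewrite factS natrM.
have step : (n.+1%:R / n.+2%:R) ^+ n.+2 <= (expR 1)^-1 :> R.
  have -> : n.+1%:R / n.+2%:R = 1 + - n.+2%:R^-1 :> R.
    by field; rewrite gt_eqF //; have := ler0n R n; lra.
  rewrite -expRN (_ : -1 = n.+2%:R * - n.+2%:R^-1) ?expRM_natl; last first.
    by rewrite mulrN mulfV // pnatr_eq0.
  apply: lerXn2r; rewrite ?nnegrE ?expR_ge0 ?expR_ge1Dx //.
  by rewrite subr_ge0 invf_le1 ?ltr0n // ler1n.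
apply: le_trans (ler_wpM2l (ler0n _ _) IH) _.
rewrite mulrA mulrA [n.+2%:R * _]mulrC -!mulrA.
rewrite ler_pM2l // ler_pM2l ?ltr0n //.
have -> : n.+1%:R * (n.+1%:R / expR 1) ^+ n.+1 =
    (n.+2%:R / expR 1) ^+ n.+2 * (expR 1 * (n.+1%:R / n.+2%:R) ^+ n.+2) :> R.
  rewrite !expr_div_n !exprS; field.
  by rewrite !gt_eqF ?exprn_gt0 ?expR_gt0.
rewrite ler_piMr ?exprn_ge0 ?divr_ge0 ?ler0n ?expR_ge0 //.
by rewrite mulrC -ler_pdivlMr // mul1r.
Qed.

End Exponential.

(** * Bounds on [tight] from its generating function *)

Section Growth.
Variable R : realType.
Implicit Types z : R.

(* Partial sums of [e^(2z) - e^z], the exponential generating function of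
   [2^n - 1]. *)
Definition gap_series z n : R :=
  \sum_(j < n) (2 ^+ j.+1 - 1) * z ^+ j.+1 / j.+1`!%:R.

Lemma gap_seriesE z n :
  gap_series z n = series (exp_coeff (2 * z)) n.+1 - series (exp_coeff z) n.+1.
Proof.
rewrite /series /= -sumrB big_mkord big_ord_recl /= /exp_coeff /= !expr0 subrr.
rewrite add0r; apply: eq_bigr => j _.
by rewrite exprMn /bump /= add1n; ring.
Qed.

Lemma cvg_gap_series z : gap_series z n @[n --> \oo] --> expR (2 * z) - expR z.
Proof.
rewrite (_ : (fun n => _) = fun n =>
    series (exp_coeff (2 * z)) (n + 1)%N - series (exp_coeff z) (n + 1)%N);
  last first.
  by apply/funext => n; rewrite gap_seriesE addn1.
apply: cvgB.
  rewrite (cvg_shiftn 1%N (series (exp_coeff (2 * z)))).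
  exact: is_cvg_series_exp_coeff.
by rewrite (cvg_shiftn 1%N (series (exp_coeff z)));
  apply: is_cvg_series_exp_coeff.
Qed.

Lemma gap_series_le z n : 0 <= z -> gap_series z n <= expR (2 * z) - expR z.
Proof.
move=> z_ge0.
have /cvg_lim <- // : gap_series z n @[n --> \oo] --> expR (2 * z) - expR z.
  exact: cvg_gap_series.
apply: nondecreasing_cvgn_le; last first.
  by apply/cvg_ex; eexists; exact: cvg_gap_series.
apply/nondecreasing_seqP => k; rewrite /gap_series big_ord_recr /= lerDl.
rewrite divr_ge0 ?ler0n // mulr_ge0 ?exprn_ge0 //.
by rewrite subr_ge0 exprn_ege1 // ler1n.
Qed.

(** The degree [n+1] part of [F = 1 + h F], for [F] the exponential generating function of
    [tight1]. *)
Lemma tight1_egf z n : 0 < z ->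
  (tight1 n.+1)%:R / n.+1`!%:R * z ^+ n.+1 =
  \sum_(j < n.+1) (2 ^+ j.+1 - 1) * z ^+ j.+1 / j.+1`!%:R *
    ((tight1 (n - j))%:R / (n - j)`!%:R * z ^+ (n - j)).
Proof.
move=> z_gt0; rewrite tight1_rec !mulr_suml; apply: eq_bigr => j _.
have le_j : (j <= n)%N by rewrite -ltnS.
have le_j' : (j.+1 <= n.+1)%N by [].
have : 'C(n.+1, j.+1)%:R * (j.+1`!%:R * (n - j)`!%:R) = n.+1`!%:R :> R.
  by rewrite -!natrM -(bin_fact le_j').
rewrite -mulr_natr => <-.
rewrite -[in z ^+ n.+1](subnKC le_j') subSS exprD; field.
by rewrite !pnatr_eq0 -!lt0n !fact_gt0 bin_gt0 le_j'.
Qed.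

(** Each term is a combination of earlier ones with nonnegative weights of total at most
    [h(z) <= 1]. *)
Lemma tight1_le z n : 0 < z -> expR (2 * z) - expR z <= 1 ->
  (tight1 n)%:R / n`!%:R * z ^+ n <= 1.
Proof.
move=> z_gt0 le1; elim/ltn_ind: n => -[|n] IH.
  by rewrite fact0 expr0 divr1 mulr1.
rewrite tight1_egf //; apply: le_trans le1.
apply: le_trans (gap_series_le n.+1 (ltW z_gt0)); apply: ler_sum => j _.
rewrite ler_piMr ?IH ?ltnS ?leq_subr //.
rewrite divr_ge0 ?ler0n // mulr_ge0 ?exprn_ge0 ?(ltW z_gt0) //.
by rewrite subr_ge0 exprn_ege1 // ler1n.
Qed.

(** If [h(z) > 1], finitely many weights already sum to more than 1, so a lower bound for an initial
    segment propagates. *)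
Lemma tight1_ge z : 0 < z -> 1 < expR (2 * z) - expR z ->
  exists2 c : R, 0 < c & forall n, c <= (tight1 n)%:R / n`!%:R * z ^+ n.
Proof.
move=> z_gt0 gt1.
pose u n : R := (tight1 n)%:R / n`!%:R * z ^+ n.
have u_gt0 n : 0 < u n.
  rewrite mulr_gt0 ?exprn_gt0 // divr_gt0 ?ltr0n ?fact_gt0 //.
  by have := tight1_ge_pow n; have := expn_gt0 2 n; lia.
have [N _ HN] := cvgr_gt _ (@cvg_gap_series z) _ gt1.
have {}HN : 1 < gap_series z N by apply: HN => /=.
have [c c_gt0 cN] : exists2 c : R, 0 < c & forall n, (n <= N)%N -> c <= u n.
  elim: N {HN} => [|N [c c_gt0 IH]].
    by exists (u 0%N) => // n; rewrite leqn0 => /eqP ->.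
  exists (Num.min c (u N.+1)); first by rewrite lt_min c_gt0 u_gt0.
  move=> n; rewrite leq_eqVlt => /orP[/eqP ->|].
    by rewrite ge_min lexx orbT.
  by rewrite ltnS => /IH; rewrite ge_min => ->.
exists c => // n; elim/ltn_ind: n => n IH.
have [/cN//|ltNn] := leqP n N.
case: n => // n in ltNn IH *.
rewrite tight1_egf //.
have term_ge0 (j : nat) : 0 <= (2 ^+ j.+1 - 1) * z ^+ j.+1 / j.+1`!%:R :> R.
  rewrite divr_ge0 ?ler0n // mulr_ge0 ?exprn_ge0 ?(ltW z_gt0) //.
  by rewrite subr_ge0 exprn_ege1 // ler1n.
apply: (@le_trans _ _ (gap_series z N * c)); first by rewrite ler_peMl // ltW.
have leNn : (N <= n.+1)%N by lia.
pose F j := (2 ^+ j.+1 - 1) * z ^+ j.+1 / j.+1`!%:R * c.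
rewrite mulr_suml (big_ord_widen _ F leNn).
(* The terms with [j >= N] are nonnegative and are dropped. *)
rewrite big_mkcond; apply: ler_sum => j _.
case: ifP => _; last by rewrite mulr_ge0 ?term_ge0 // ltW // u_gt0.
by apply: ler_wpM2l; rewrite ?term_ge0 // IH // ltnS leq_subr.
Qed.

End Growth.

(** * The limit constant and its numerical value *)

Section Limit.
Variable R : realType.

Definition golden : R := (1 + Num.sqrt 5%:R) / 2%:R.

Definition tight_radius : R := ln golden.

Definition tight_growth : R := (expR 1 * tight_radius)^-1.

(** For positive [n] this is [tight(n)^(1/n) / n]; the logarithmic form suits the limit. *)
Definition tight_root n : R := expR (ln (tight n)%:R / n%:R - ln n%:R).

Lemma sqrt5_bounds :
  2236%:R / 1000%:R <= Num.sqrt (5%:R : R) <= 2237%:R / 1000%:R.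
Proof.
by apply/andP; split; rewrite -(@ler_pXn2r _ 2) ?nnegrE ?sqrtr_ge0 ?divr_ge0
  ?ler0n // sqr_sqrtr ?ler0n //; lra.
Qed.

Lemma golden_gt0 : 0 < golden.
Proof. by rewrite divr_gt0 // ltr_pwDl // sqrtr_ge0. Qed.

Lemma goldenE : golden ^+ 2 - golden = 1.
Proof.
have : Num.sqrt 5%:R ^+ 2 = 5%:R :> R by rewrite sqr_sqrtr ?ler0n.
by rewrite /golden; move: (Num.sqrt _) => s hs; field: hs.
Qed.

Lemma expR_tight_radius : expR tight_radius = golden.
Proof. by rewrite lnK // posrE golden_gt0. Qed.

Lemma gap_tight_radius : expR (2 * tight_radius) - expR tight_radius = 1.
Proof. by rewrite mulr_natl mulr2n expRD expR_tight_radius -expr2 goldenE. Qed.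

Lemma series_exp7 (x : R) : series (exp_coeff x) 7 =
  1 + x + x ^+ 2 / 2%:R + x ^+ 3 / 6%:R + x ^+ 4 / 24%:R + x ^+ 5 / 120%:R +
  x ^+ 6 / 720%:R.
Proof.
rewrite /series /= !big_nat_recr //= big_geq // add0r /exp_coeff /=.
by rewrite expr0 expr1 !divr1.
Qed.

(** The error term is twice the first omitted one, [2 x^7 / 7! = x^7 / 2520]. *)
Lemma expR_bounds7 (x : R) : 0 <= x <= 1 ->
  let s := 1 + x + x ^+ 2 / 2%:R + x ^+ 3 / 6%:R + x ^+ 4 / 24%:R +
           x ^+ 5 / 120%:R + x ^+ 6 / 720%:R in
  s <= expR x <= s + x ^+ 7 / 2520%:R.
Proof.
move=> /andP[x0 x1] /=; rewrite -series_exp7 series_exp_le //=.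
apply: le_trans (@expR_le_series R x 7 x0 _) _; first by lra.
rewrite lerD2l /exp_coeff /= (_ : 7`! = 2 * 2520)%N // natrM.
by rewrite -subr_ge0 le_eqVlt; apply/orP; left; apply/eqP; field.
Qed.

Lemma tight_radius_bounds :
  481%:R / 1000%:R <= tight_radius <= 486%:R / 1000%:R.
Proof.
have /andP[s1 s2] := sqrt5_bounds.
apply/andP; split; rewrite -ler_expR expR_tight_radius /golden.
  have [|_ le] := andP (@expR_bounds7 (481%:R / 1000%:R) _); first by lra.
  by apply: le_trans le _; lra.
have [|ge _] := andP (@expR_bounds7 (486%:R / 1000%:R) _); first by lra.
by apply: le_trans ge; lra.
Qed.

Lemma expR1_bounds : 2718%:R / 1000%:R <= expR (1 : R) <= 2720%:R / 1000%:R.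
Proof.
have [|ge le] := andP (@expR_bounds7 1 _); first by lra.
by apply/andP; split; [apply: le_trans ge | apply: le_trans le _]; lra.
Qed.

Lemma tight_radius_gt0 : 0 < tight_radius.
Proof. by have /andP[? _] := tight_radius_bounds; lra. Qed.

Lemma tight_growth_bound : `|tight_growth - 76%:R / 100%:R| <= 5%:R / 1000%:R.
Proof.
have /andP[e1 e2] := expR1_bounds; have /andP[z1 z2] := tight_radius_bounds.
rewrite /tight_growth.
move: (expR 1) tight_radius e1 e2 z1 z2 => e z e1 e2 z1 z2.
(* Reciprocals of [[1.3072, 1.324]] lie in [[0.755, 0.765]]. *)
have [x1 x2] : 3268%:R / 2500%:R <= e * z /\ e * z <= 1324%:R / 1000%:R.
  by split; nra.
move: (e * z) x1 x2 => x x1 x2.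
have x0 : 0 < x by lra.
rewrite ler_distl -[x^-1]div1r ler_pdivlMr // ler_pdivrMr //.
by apply/andP; split; lra.
Qed.

Lemma tight_gt0 n : (0 < n)%N -> (0 < tight n)%N.
Proof.
case: n => // n _; have := tight1_ge_pow n.+1.
by have := expn_gt0 2 n.+1; rewrite /=; lia.
Qed.

Lemma tight_rootE n : (0 < n)%N -> (tight n)%:R = (tight_root n * n%:R) ^+ n.
Proof.
move=> n_gt0; have nR : 0 < n%:R :> R by rewrite ltr0n.
rewrite -[X in _ * X]lnK ?posrE // -expRD subrK -expRM_natr divfK ?gt_eqF //.
by rewrite lnK // posrE ltr0n tight_gt0.
Qed.

Lemma ln_growth : ln tight_growth = - 1 - ln tight_radius.
Proof.
have e0 := expR_gt0 (1 : R); have z0 := tight_radius_gt0.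
rewrite lnV ?posrE ?mulr_gt0 // lnM ?posrE //.
by rewrite -[X in ln X]/(expR 1) expRK opprD.
Qed.

Lemma ln_tight_factor n z : (0 < n)%N -> 0 < z ->
  ln ((tight1 n)%:R / n`!%:R * z ^+ n) =
    ln (tight n)%:R - ln n`!%:R + n%:R * ln z :> R.
Proof.
move=> n_gt0 z_gt0.
have t_gt0 : 0 < (tight n)%:R :> R by rewrite ltr0n tight_gt0.
have f_gt0 : 0 < n`!%:R :> R by rewrite ltr0n fact_gt0.
have -> : tight1 n = tight n by case: n n_gt0 {t_gt0 f_gt0}.
rewrite lnM ?posrE ?exprn_gt0 ?divr_gt0 // ln_div ?posrE // lnXn //.
by rewrite mulr_natl.
Qed.

Lemma ln_fact_bounds n : (0 < n)%N ->
  n%:R * (ln n%:R - 1) <= ln (n`!%:R : R)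
    <= 1 + ln n%:R + n%:R * (ln n%:R - 1).
Proof.
move=> n_gt0; have nR : 0 < n%:R :> R by rewrite ltr0n.
have f_gt0 : 0 < n`!%:R :> R by rewrite ltr0n fact_gt0.
have e0 := expR_gt0 (1 : R).
have lne : ln (n%:R / expR 1) = ln n%:R - 1 :> R.
  by rewrite ln_div ?posrE // expRK.
have q0 : 0 < n%:R / expR 1 :> R by rewrite divr_gt0.
apply/andP; split.
  have := factr_ge R n; rewrite -ler_ln ?posrE ?exprn_gt0 //.
  by rewrite lnXn // lne -(mulr_natl (ln _ - 1)).
case: n n_gt0 nR f_gt0 lne q0 => // n _ nR f_gt0 lne q0.
have := factr_le R n.
rewrite -ler_ln ?posrE ?mulr_gt0 ?exprn_gt0 //.
rewrite lnM ?posrE ?mulr_gt0 ?exprn_gt0 // lnXn // lne.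
by rewrite -(mulr_natl (ln _ - 1)) lnM ?posrE // expRK.
Qed.

(** The upper bound is taken at the radius, where [h = 1]; the lower one at [e^eps] times the
    radius, where [h > 1]. This shift changes the logarithm by [eps]. *)
Lemma tight_root_bound eps : 0 < eps ->
  exists C : R, forall n, (0 < n)%N ->
    `|ln (tight_root n) - ln tight_growth| <= eps + C / n%:R.
Proof.
move=> eps_gt0; set z := tight_radius * expR eps.
have z0 := tight_radius_gt0.
have z_gt0 : 0 < z by rewrite mulr_gt0 ?expR_gt0.
have lnz : ln z = ln tight_radius + eps.
  by rewrite lnM ?posrE ?expR_gt0 // expRK.
have gap_gt1 : 1 < expR (2 * z) - expR z.
  have lt_z : tight_radius < z by rewrite ltr_pMr // expR_gt1.
  have := goldenE; rewrite -expR_tight_radius => gE.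
  move: lt_z; rewrite -ltr_expR => lt_z.
  (* With [g = e^z], [h = g^2 - g] is increasing for [g >= 1]. *)
  have g1 : 1 <= expR tight_radius by have := expR_ge1Dx tight_radius; lra.
  rewrite mulr_natl mulr2n expRD.
  by nra.
have [c c_gt0 cP] := tight1_ge z_gt0 gap_gt1.
(* [- ln c] pays for the lower bound, [- ln eps] for the [1 + ln n] in the factorial estimate,
   through [ln y <= y - 1] at [y = eps n]. *)
exists (Num.max (- ln c) (- ln eps)) => n n_gt0.
have nR : 0 < n%:R :> R by rewrite ltr0n.
have up : ln (tight n)%:R <= ln n`!%:R - n%:R * ln tight_radius.
  have := @tight1_le R tight_radius n z0.
  rewrite gap_tight_radius => /(_ (lexx _)).
  rewrite -ler_ln ?posrE ?ltr01 //; last first.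
    have t1 : (0 < tight1 n)%N by have := tight_gt0 n_gt0; case: n n_gt0 {nR}.
    by rewrite mulr_gt0 ?exprn_gt0 // divr_gt0 ?ltr0n ?fact_gt0.
  by rewrite ln_tight_factor // ln1; lra.
have low : ln c + ln n`!%:R - n%:R * ln z <= ln (tight n)%:R.
  have := cP n; rewrite -ler_ln ?posrE //; last exact: lt_le_trans (cP n).
  by rewrite ln_tight_factor //; lra.
have /andP[f1 f2] := ln_fact_bounds n_gt0.
have lnn : ln n%:R <= eps * n%:R - 1 - ln eps.
  have en_gt0 : 0 < eps * n%:R by rewrite mulr_gt0.
  have : ln (1 + (eps * n%:R - 1)) <= eps * n%:R - 1 by apply: le_ln1Dx; lra.
  by rewrite addrCA subrr addr0 lnM ?posrE //; lra.
rewrite expRK ln_growth.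
set D := Num.max _ _.
have D1 : - ln c <= D by rewrite le_max lexx.
have D2 : - ln eps <= D by rewrite le_max lexx orbT.
have -> : ln (tight n)%:R / n%:R - ln n%:R - (-1 - ln tight_radius) =
  (ln (tight n)%:R - n%:R * (ln n%:R - 1 - ln tight_radius)) / n%:R.
  by field; rewrite gt_eqF.
have -> : eps + D / n%:R = (eps * n%:R + D) / n%:R by field; rewrite gt_eqF.
rewrite normrM (gtr0_norm (x := n%:R^-1)) ?invr_gt0 // ler_pM2r ?invr_gt0 //.
rewrite ler_norml; rewrite lnz in low.
by apply/andP; split; lra.
Qed.

Lemma cvg_tight_root : tight_root n @[n --> \oo] --> tight_growth.
Proof.
have g0 : 0 < tight_growth.
  by rewrite invr_gt0 mulr_gt0 ?expR_gt0 ?tight_radius_gt0.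
suff ln_cvg : ln (tight_root n) @[n --> \oo] --> ln tight_growth.
  have -> : tight_root = fun n => expR (ln (tight_root n)).
    by apply/funext => n; rewrite expRK.
  rewrite -[X in _ --> X]lnK ?posrE //.
  exact: (continuous_cvg _ (@continuous_expR R _) ln_cvg).
apply/cvgrPdist_le => e e_gt0.
have e2_gt0 : 0 < e / 2 by lra.
have [C CP] := tight_root_bound e2_gt0.
have [D [D0 CD]] : exists D, 0 < D /\ C <= D.
  by exists (Num.max 1 C); rewrite lt_max ltr01 le_max lexx orbT.
near=> n.
have n_gt0 : (0 < n)%N by near: n; exact: nbhs_infty_gt.
have nR : 0 < n%:R :> R by rewrite ltr0n.
rewrite distrC; apply: le_trans (CP n n_gt0) _.
have : D / (e / 2) <= n%:R by near: n; exact: nbhs_infty_ger.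
rewrite ler_pdivrMr; last by lra.
move=> h; have : C / n%:R <= e / 2 by rewrite ler_pdivrMr //; lra.
by lra.
Unshelve. all: by end_near. Qed.

End Limit.

(** * The bounds on the number of states *)

Theorem theorem2 (R : realType) :
  [/\ (* |Q'| is in O(k^n * tight(n+1)) *)
      exists C : R, forall (Q Sigma : finType) (c : nat) (A : tela Q Sigma c),
        inf_tela A -> min_models A != finset.set0 ->
        let n := #|Q| in let k := #|min_models A| in
        #|tba_state (complement_tba A)|%:R <= C * (k%:R ^+ n * (tight n.+1)%:R),
      (* tight(n) = (kappa n + o(n))^n with kappa = 0.76 to two decimals, and
         |Q'| is in O(n (kappa n k + o(n) k)^n) for the same o(n) *)
      exists (kappa : R) (theta : nat -> R),
        [/\ `|kappa - 76%:R / 100%:R| <= 5%:R / 1000%:R,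
            theta n @[n --> \oo] --> kappa,
            forall n, (0 < n)%N -> (tight n)%:R = (theta n * n%:R) ^+ n
          & exists C : R,
              forall (Q Sigma : finType) (c : nat) (A : tela Q Sigma c),
              inf_tela A -> min_models A != finset.set0 ->
              let n := #|Q| in let k := #|min_models A| in
              (0 < n)%N ->
              #|tba_state (complement_tba A)|%:R
                <= C * (n%:R * (theta n * n%:R * k%:R) ^+ n)]
    & (* the printed form, for any constant b admissible in the estimate *)
      forall b : R, 0 < b ->
        (exists D : R, forall n, (0 < n)%N ->
           (tight n)%:R <= D * (b * n%:R) ^+ n) ->
        exists C : R,
          forall (Q Sigma : finType) (c : nat) (A : tela Q Sigma c),
          inf_tela A -> min_models A != finset.set0 ->
          let n := #|Q| in let k := #|min_models A| in
          (0 < n)%N ->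
          #|tba_state (complement_tba A)|%:R
            <= C * (n%:R * (b * n%:R * k%:R) ^+ n)].
Proof.
have bound (Q Sigma : finType) (c : nat) (A : tela Q Sigma c) :
    min_models A != finset.set0 -> (0 < #|Q|)%N ->
    #|tba_state (complement_tba A)|%:R <=
      8%:R * (#|Q|%:R * (#|min_models A|%:R ^+ #|Q| * (tight #|Q|)%:R)) :> R.
  move=> A0 n_gt0; rewrite -natrX -!natrM ler_nat.
  exact: card_complement.
split.
- exists 8%:R => Q Sigma c A _ A0; cbv zeta.
  (* For [n = 0] there is one state, and [tight 1 >= 1]. *)
  have [n0|n_gt0] := posnP #|Q|.
    rewrite card_complement0 // n0 expr0 mul1r -natrM ler_nat.
    by have := tight1_ge_pow 1; rewrite /=; lia.
  apply: le_trans (bound _ _ _ A A0 n_gt0) _.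
  rewrite ler_pM2l ?ltr0n // mulrCA ler_wpM2l ?exprn_ge0 //.
  (* The linear factor is absorbed by [n tight(n) <= tight(n+1)]. *)
  rewrite -natrM ler_nat; have := tight1S_ge #|Q|.
  have -> : tight1 #|Q| = tight #|Q| by rewrite /tight1; case: #|Q| n_gt0.
  by apply: leq_trans; rewrite leq_mul.
- exists (tight_growth R), (tight_root R); split.
  + exact: tight_growth_bound.
  + exact: cvg_tight_root.
  + exact: tight_rootE.
  exists 8%:R => Q Sigma c A _ A0 n k n_gt0.
  apply: le_trans (bound _ _ _ A A0 n_gt0) _.
  by rewrite exprMn (tight_rootE R n_gt0) [_ * k%:R ^+ n]mulrC.
- move=> b b_gt0 [D DP].
  exists (8%:R * D) => Q Sigma c A _ A0 n k n_gt0.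
  apply: le_trans (bound _ _ _ A A0 n_gt0) _.
  rewrite -mulrA ler_pM2l ?ltr0n // [leRHS]mulrCA ler_wpM2l //.
  rewrite [(_ * k%:R) ^+ n]exprMn mulrA [leRHS]mulrC.
  by rewrite ler_wpM2l ?exprn_ge0 // DP.
Qed.
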